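(* Let $U$ be the unitary of a CNOT circuit on $n$ qubits, with parity matrix $A\in GL_n(\mathbb{F}_2)$, and let $c\ge 0$ be the number of blocks in the generalized Jordan normal form of $A$ over $\mathbb{F}_2$ whose polynomial is of the form $f(x)=(x+1)^d$. Then the controlled unitary $c(U)$ can be implemented using $n-c$ Toffoli gates. Moreover, this uses at most $\tfrac32$ times the optimum number of Toffoli gates, i.e. $n-c\le\tfrac32\,\mathrm{Opt}(U)$, where $\mathrm{Opt}(U)$ is the minimum number of Toffoli gates required to implement $c(U)$.
   Context: A CNOT circuit on $n$ qubits is a product of CNOT gates; its unitary acts on computational basis states as $U|\vec x\rangle=|A\vec x\rangle$ for all $\vec x\in\mathbb{F}_2^n$, for a unique $A\in GL_n(\mathbb{F}_2)$, called its parity matrix. For a unitary $U$ on $n$ qubits, $c(U)$ is the unitary on $n+1$ qubits with $c(U)(|0\rangle\otimes|\psi\rangle)=|0\rangle\otimes|\psi\rangle$ and $c(U)(|1\rangle\otimes|\psi\rangle)=|1\rangle\otimes U|\psi\rangle$. Implementations are circuits made of Clifford gates (generated by $H$, $S$, CNOT; free, not counted) and Toffoli gates; only the Toffoli gates are counted. The optimum is over the circuits of Clifford and Toffoli gates that implement $c(U)$. Generalized Jordan normal form: every square matrix $A$ over $\mathbb{F}_2$ is similar over $\mathbb{F}_2$ to a block diagonal matrix $C_{f_1}\oplus\cdots\oplus C_{f_k}$, where each $f_i\in\mathbb{F}_2[x]$ is a power of an irreducible polynomial (the $f_i$ are the elementary divisors of $A$), and for $f=a_0+a_1x+\cdots+a_{d-1}x^{d-1}+x^d$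 the companion matrix $C_f$ is the $d\times d$ matrix with ones on the subdiagonal, last column $(a_0,a_1,\dots,a_{d-1})^T$ (signs are irrelevant over $\mathbb{F}_2$), and zeros elsewhere. The $C_{f_i}$ are the blocks of the form. *)

(* Defs.v *)
From HB Require Import structures.
From mathcomp Require Import all_boot all_order all_algebra.

Set Implicit Arguments.
Unset Strict Implicit.
Unset Printing Implicit Defensive.

Import Order.TTheory GRing.Theory Num.Theory.
Local Open Scope ring_scope.

(* Labels of the computational basis of n qubits. *)
Notation basis n := ('cV['F_2]_n).

(* Amplitude functions on the computational basis. The scalars C range over
   numClosedFieldType, which covers R[i] for R real closed as well as algC. *)
Notation state C n := ({ffun basis n -> C^o}).

Section States.
Variable C : numClosedFieldType.

Definition ket n (x : basis n) : state C n := [ffun y => (y == x)%:R].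

(* phi (x) psi; the qubits of phi come first. *)
Definition tens m n (phi : state C m) (psi : state C n) : state C (m + n) :=
  [ffun x => phi (usubmx x) * psi (dsubmx x)].

Definition lin_ext_fun m n (F : basis m -> state C n) (phi : state C m) :
  state C n := \sum_x phi x *: F x.

Fact lin_ext_is_linear m n (F : basis m -> state C n) :
  linear (lin_ext_fun F).
Proof.
move=> a phi psi; rewrite /lin_ext_fun scaler_sumr -big_split /=.
by apply: eq_bigr => x _; rewrite !ffunE scalerDl scalerA.
Qed.

HB.instance Definition _ m n (F : basis m -> state C n) :=
  GRing.isLinear.Build C (state C m) (state C n) _ (lin_ext_fun F)
    (lin_ext_is_linear F).

(* The linear map that sends |x> to F x for every basis label x. *)
Definition lin_ext m n (F : basis m -> state C n) :
  'Hom(state C m, state C n) := linfun (lin_ext_fun F).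

Lemma lin_ext_ket m n (F : basis m -> state C n) x : lin_ext F (ket x) = F x.
Proof.
rewrite lfunE /= /lin_ext_fun (bigD1 x) //= big1 => [|y /negPf neq_yx].
  by rewrite ffunE eqxx scale1r addr0.
by rewrite ffunE neq_yx scale0r.
Qed.

Lemma state_sum_ket n (psi : state C n) : psi = \sum_x psi x *: ket x.
Proof.
apply/ffunP=> y; rewrite sum_ffunE (bigD1 y) //= big1 => [|x neq_xy].
  by rewrite !ffunE eqxx addr0 [_ *: _]mulr1.
by rewrite !ffunE eq_sym (negPf neq_xy) scaler0.
Qed.

Definition controlled n (U : 'End(state C n)) : 'End(state C (1 + n)) :=
  lin_ext (fun x : basis (1 + n) =>
    if usubmx x == 0 then ket x
    else tens (ket (const_mx 1)) (U (ket (dsubmx x)))).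

End States.

Section Gates.
Variable n : nat.

Inductive gate : Type :=
| H_gate of 'I_n
| S_gate of 'I_n
| CNOT_gate (ctl tgt : 'I_n) of ctl != tgt
| TOF_gate (ctl1 ctl2 tgt : 'I_n) of uniq [:: ctl1; ctl2; tgt].

(* The head of the list is the gate that is applied first. *)
Definition circuit := seq gate.

Definition is_CNOT (g : gate) : bool :=
  if g is CNOT_gate _ _ _ then true else false.

Definition is_TOF (g : gate) : bool :=
  if g is TOF_gate _ _ _ _ then true else false.

Definition toffoli_count (c : circuit) : nat := count is_TOF c.

Definition set_bit (x : basis n) (i : 'I_n) (b : 'F_2) : basis n :=
  \col_k (if k == i then b else x k 0).

Variable C : numClosedFieldType.

(* The exponents coerce x i 0 : 'F_2 to the natural number 0 or 1. *)
Definition gate_ket (g : gate) (x : basis n) : state C n :=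
  match g with
  | H_gate i => (sqrtC 2)^-1 *:
      (ket C (set_bit x i 0) + (-1) ^+ (x i 0) *: ket C (set_bit x i 1))
  | S_gate i => 'i ^+ (x i 0) *: ket C x
  | CNOT_gate c t _ => ket C (set_bit x t (x t 0 + x c 0))
  | TOF_gate c1 c2 t _ => ket C (set_bit x t (x t 0 + x c1 0 * x c2 0))
  end.

Definition gate_op (g : gate) : 'End(state C n) := lin_ext (gate_ket g).

Definition circuit_op (c : circuit) : 'End(state C n) :=
  foldr (fun g V => (V \o gate_op g)%VF) \1%VF c.

Definition is_CNOT_circuit_op (U : 'End(state C n)) : Prop :=
  exists2 c : circuit, all is_CNOT c & U = circuit_op c.

Definition parity_matrix (U : 'End(state C n)) (A : 'M['F_2]_n) : Prop :=
  A \in unitmx /\ forall x : basis n, U (ket C x) = ket C (A *m x).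

Definition implementable_with (W : 'End(state C n)) (t : nat) : Prop :=
  exists2 c : circuit, circuit_op c = W & toffoli_count c = t.

Definition is_toffoli_opt (W : 'End(state C n)) (t : nat) : Prop :=
  implementable_with W t /\ forall s, implementable_with W s -> (t <= s)%N.

End Gates.

Section ControlledSpec.
Variables (C : numClosedFieldType) (n : nat) (U : 'End(state C n)).

Let tens_ketE (b : basis 1) (psi : state C n) :
  tens (ket C b) psi = \sum_x psi x *: ket C (col_mx b x).
Proof.
apply/ffunP=> y; rewrite sum_ffunE !ffunE.
rewrite (bigD1 (dsubmx y)) //= big1 => [|x neq_xy]; last first.
  rewrite !ffunE [_ == _](_ : _ = false) ?scaler0 //.
  by apply: contraNF neq_xy => /eqP->; rewrite col_mxKd.
rewrite !ffunE addr0 mulrC; congr (_ * (_ : bool)%:R).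
by apply/eqP/eqP => [<-|->]; rewrite ?vsubmxK ?col_mxKu.
Qed.

Lemma controlled0 (psi : state C n) :
  controlled U (tens (ket C 0) psi) = tens (ket C 0) psi.
Proof.
rewrite tens_ketE linear_sum; apply: eq_bigr => x _ /=.
by rewrite linearZ /= lin_ext_ket col_mxKu eqxx.
Qed.

Lemma controlled1 (psi : state C n) :
  controlled U (tens (ket C (const_mx 1)) psi) =
  tens (ket C (const_mx 1)) (U psi).
Proof.
rewrite tens_ketE linear_sum {2}[psi]state_sum_ket linear_sum.
transitivity
  (\sum_x psi x *: tens (ket C (const_mx 1 : basis 1)) (U (ket C x))).
  apply: eq_bigr => x _ /=; rewrite linearZ /= lin_ext_ket col_mxKu col_mxKd.
  by rewrite ifN //; apply/eqP => /matrixP/(_ 0 0); rewrite !mxE.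
apply/ffunP=> y; rewrite sum_ffunE [RHS]ffunE sum_ffunE mulr_sumr.
by apply: eq_bigr => x _; rewrite linearZ /= !ffunE [LHS]mulrCA.
Qed.

End ControlledSpec.

Section GeneralizedJordan.

Definition irreducible_power (f : {poly 'F_2}) : Prop :=
  exists p d, [/\ irreducible_poly p, (0 < d)%N & f = p ^+ d].

(* MathComp's companionmx has its ones on the superdiagonal and the negated
   coefficients in the last row, hence the transpose; signs vanish over F_2. *)
Definition companion_blocks k (f : 'I_k -> {poly 'F_2}) :
  'M['F_2]_(\sum_(i < k) (size (f i)).-1) :=
  \mxdiag_(i < k) (companionmx (f i))^T.

Definition gen_jordan_form n (A : 'M['F_2]_n) k (f : 'I_k -> {poly 'F_2}) :
  Prop :=
  (forall i, irreducible_power (f i)) /\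
  exists e : (\sum_(i < k) (size (f i)).-1)%N = n,
    A ~_{in unitmx} (castmx (e, e) (companion_blocks f)).

(* If f = (X + 1)^d then d = (size f).-1, so the bound on d loses nothing. *)
Definition is_X1_power (f : {poly 'F_2}) : bool :=
  [exists d : 'I_(size f), f == ('X + 1) ^+ d].

Definition X1_power_blocks k (f : 'I_k -> {poly 'F_2}) : nat :=
  #|[set i | is_X1_power (f i)]|.

End GeneralizedJordan.

(* Main.v *)
Require Import Defs.
From mathcomp Require Import all_boot all_order all_algebra.
From Stdlib Require Import Classical_Prop.
Import Order.TTheory GRing.Theory Num.Theory.
Local Open Scope ring_scope.

(** Each block of the generalized Jordan form has a kernel of dimension at most
    one after subtracting the identity, and it is nonzero exactly for the blocks
    of (x+1)^d; hence n - c is the rank r of A - 1.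

    Upper bound: over F_2, every A in GL_n is a product of r transvections
    1 + u v with v u = 0, and a controlled transvection is a single Toffoli gate
    conjugated by CNOT gates.

    Lower bound: the Pauli operators that a unitary conjugates to Pauli
    operators lose at most three dimensions per Toffoli gate and none per
    Clifford gate. For c(U), a Pauli operator X^a Z^b on the target can only be
    conjugated to a Pauli operator if A a = a and b A = b, which is a subspace
    of codimension 2r; hence 2r <= 3t for every circuit with t Toffoli gates. *)

Set Implicit Arguments.
Unset Strict Implicit.
Unset Printing Implicit Defensive.

(** * Arithmetic over the two-element field *)

Lemma F2_cases (z : 'F_2) : {z = 0} + {z = 1}.
Proof.
by case: z => [[|[|m]] lt_m2] //; [left | right]; apply: val_inj.
Qed.

Lemma F2_neq0 (z : 'F_2) : z != 0 -> z = 1.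
Proof. by case: (F2_cases z) => ->. Qed.

Lemma F2_oppr (z : 'F_2) : - z = z.
Proof. by case: (F2_cases z) => ->; apply: val_inj. Qed.

Lemma F2_addrr (z : 'F_2) : z + z = 0.
Proof. by case: (F2_cases z) => ->; apply: val_inj. Qed.

Lemma F2_addvv (V : lmodType 'F_2) (v : V) : v + v = 0.
Proof.
rewrite -[v]scale1r -scalerDl (_ : 1 + 1 = 0) ?scale0r //.
exact: F2_addrr.
Qed.

(** * Elementary divisors and the rank of A - 1 *)

(** The ones on the subdiagonal force z_(j+1) = a z_j for a left eigenvector z, so z is a multiple
    of (1, a, a^2, ...) and the eigenspace is at most a line. It is nonzero exactly when a is a root
    of the characteristic polynomial, which is [f]. *)
Lemma eigenspace_companionmx_rank (F : fieldType) (f : {poly F}) (a : F) :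
    f \is monic -> (1 < size f)%N ->
  \rank (eigenspace (companionmx f)^T a) = root f a.
Proof.
move=> f_monic f_gt1.
have rank_neq0: (\rank (eigenspace (companionmx f)^T a) != 0%N) = root f a.
  rewrite mxrank_eq0 -[_ != _]/(eigenvalue _ a) eigenvalue_root_char.
  rewrite -[in RHS](companionmxK f_monic) /char_poly -[in RHS]det_tr.
  rewrite /char_poly_mx.
  congr (root (\det _) a).
  by apply/matrixP=> i j; rewrite !mxE eq_sym.
suff rank_le1: (\rank (eigenspace (companionmx f)^T a) <= 1)%N.
  by move: rank_neq0 rank_le1; case: (\rank _) => [|[]] //= <-.
pose v : 'rV[F]_(size f).-1 := \row_j a ^+ j.
apply: leq_trans (rank_leq_row v); apply: mxrankS; apply/rV_subP => z.
move=> /eigenspaceP zC.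
have d_gt0: (0 < (size f).-1)%N by rewrite -subn1 subn_gt0.
suff ->: z = z 0 (Ordinal d_gt0) *: v by apply: scalemx_sub.
apply/rowP => -[j lt_jd]; rewrite !mxE /=; elim: j lt_jd => [|j IHj] lt_jd.
  by rewrite mulr1; congr (z 0 _); apply: val_inj.
have lt_jd' := ltnW lt_jd.
rewrite exprS mulrCA -(IHj lt_jd').
move/rowP/(_ (Ordinal lt_jd')): zC; rewrite !mxE => <-.
have neq_jd : (j == (size f).-1.-1) = false.
  by rewrite ltn_eqF // -ltnS prednK.
rewrite (bigD1 (Ordinal lt_jd)) //= !mxE /= neq_jd eqxx mulr1.
rewrite big1 ?addr0 // => i neq_i; rewrite !mxE /= neq_jd.
by rewrite eq_sym -[_ == _]/(i == Ordinal lt_jd) (negPf neq_i) mulr0.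
Qed.

Lemma irreducible_power_gt1 (f : {poly 'F_2}) :
  irreducible_power f -> (1 < size f)%N.
Proof.
case=> p [d [[p_gt1 _] d_gt0 ->]].
have : (0 < (size (p ^+ d)).-1)%N.
  by rewrite size_exp muln_gt0 d_gt0 andbT; case: (size p) p_gt1 => [|[]].
by case: (size _) => [|[|]].
Qed.

Lemma F2_poly_monic (f : {poly 'F_2}) : f != 0 -> f \is monic.
Proof. by move=> f_neq0; apply/eqP/F2_neq0; rewrite lead_coef_eq0. Qed.

(** If p^d vanishes at 1, then X - 1 divides p, and irreducibility makes p equal to X - 1 = X + 1.
    Conversely (X + 1)^d vanishes at 1 unless d = 0, which is excluded because [f] is not
    constant. *)
Lemma is_X1_powerE (f : {poly 'F_2}) :
  irreducible_power f -> is_X1_power f = root f 1.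
Proof.
move=> f_irr; have f_gt1 := irreducible_power_gt1 f_irr.
have X1E: 'X + 1 = 'X - 1%:P :> {poly 'F_2} by rewrite -polyCN F2_oppr.
apply/existsP/idP => [[[[|e] lt_e] /eqP /= fE]|].
- by move: f_gt1; rewrite fE expr0 size_poly1.
- by rewrite fE rootE X1E !hornerE subrr expr0n.
case: f_irr f_gt1 => p [d [[p_gt1 p_irr] d_gt0 ->]] f_gt1.
have p_neq0 : p != 0 by rewrite -size_poly_gt0 ltnW.
rewrite rootE horner_exp expf_eq0 d_gt0 /= -rootE -dvdp_XsubCl => X1_dvd_p.
have pE : p = 'X + 1.
  apply/eqP; rewrite X1E eq_sym -eqp_monic ?monicXsubC ?F2_poly_monic //.
  by apply: p_irr => //; rewrite size_XsubC.
have lt_d : (d < size (p ^+ d))%N.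
  move: f_gt1; rewrite pE X1E => f_gt1; rewrite -(prednK (ltnW f_gt1)).
  by rewrite size_exp size_XsubC mul1n.
by exists (Ordinal lt_d); rewrite /= -pE.
Qed.

Lemma rank_gen_jordan_form n (A : 'M['F_2]_n) k (f : 'I_k -> {poly 'F_2}) :
  gen_jordan_form A f -> \rank (A - 1%:M) = (n - X1_power_blocks f)%N.
Proof.
case=> f_irr [e [P P_unit /(simmxP P_unit) PA]].
have gt1 i : (1 < size (f i))%N.
  exact: irreducible_power_gt1.
have monic_f i : f i \is monic.
  by apply: F2_poly_monic; rewrite -size_poly_gt0 ltnW.
have ->: \rank (A - 1%:M) = \rank (companion_blocks f - 1%:M).
  have P_free : row_free P by rewrite row_free_unit.
  have P_full : row_full P by rewrite row_full_unit.
  rewrite -(eqmxMfull (A - 1%:M) P_full) mulmxBr PA mulmx1.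
  rewrite -{2}[P]mul1mx -mulmxBl mxrankMfree // {PA P_free P_full P_unit}.
  by case: n / e A P => A P; rewrite castmx_id.
rewrite /companion_blocks -mxdiagZ -mxdiagB.
rewrite rank_mxdiag -e /X1_power_blocks -sum1_card.
(* Subtraction is truncated, so it can be done blockwise only because each subtracted 0 or 1 is at
   most the positive size of its block. *)
rewrite [X in (_ - X)%N]big_mkcond -sumnB => [|i _]; last first.
  rewrite -ltnS prednK ?(ltnW (gt1 i)) // (leq_trans _ (gt1 i)) //.
  by case: ifP.
apply: eq_bigr => i _.
have:= mxrank_ker ((companionmx (f i))^T - 1%:M).
rewrite eigenspace_companionmx_rank // inE is_X1_powerE //.
have:= rank_leq_row ((companionmx (f i))^T - 1%:M).
by move=> /subKn {2}<- <-; case: (root _ _).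
Qed.

(** * Circuits as maps of basis labels *)

Section Circuits.
Variable C : numClosedFieldType.

Lemma eq_on_ket m n (f g : 'Hom(state C m, state C n)) :
  (forall x, f (ket C x) = g (ket C x)) -> f = g.
Proof.
move=> eq_fg; apply/lfunP => psi; rewrite [psi]state_sum_ket !linear_sum.
by apply: eq_bigr => x _; rewrite !linearZ /= eq_fg.
Qed.

Lemma circuit_op_cat m (c1 c2 : circuit m) :
  circuit_op C (c1 ++ c2) = (circuit_op C c2 \o circuit_op C c1)%VF.
Proof.
elim: c1 => [|g c1 IHc] /=; first by rewrite comp_lfun1r.
by rewrite IHc comp_lfunA.
Qed.

(** The upper bound only needs operators that send kets to kets without a phase, so composition of
    circuits becomes composition of functions on labels. *)
Definition realizes m t (F : basis m -> basis m) : Prop :=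
  exists2 c : circuit m,
    forall x, circuit_op C c (ket C x) = ket C (F x) & toffoli_count c = t.

Lemma realizes_ext m t (F G : basis m -> basis m) :
  F =1 G -> realizes t F -> realizes t G.
Proof. by move=> eqFG [c cF ct]; exists c => // x; rewrite cF eqFG. Qed.

Lemma realizes_id m : realizes 0 (@id (basis m)).
Proof. by exists [::] => // x; rewrite /= lfunE. Qed.

Lemma realizes_comp m s t (F G : basis m -> basis m) :
  realizes s F -> realizes t G -> realizes (s + t) (G \o F).
Proof.
move=> [c cF <-] [d dG <-]; exists (c ++ d); last exact: count_cat.
by move=> x; rewrite circuit_op_cat lfunE /= cF dG.
Qed.

Lemma set_bitD m (x : basis m) i b :
  set_bit x i (x i 0 + b) = x + b *: delta_mx i 0.
Proof.
apply/colP=> k; rewrite !mxE eqxx andbT; case: eqP => [->|_].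
  by rewrite mulr1.
by rewrite mulr0 addr0.
Qed.

Definition row_dot m (w : 'rV['F_2]_m) (x : basis m) : 'F_2 := (w *m x) 0 0.

Lemma row_dot_delta m i (x : basis m) : row_dot (delta_mx 0 i) x = x i 0.
Proof. by rewrite /row_dot -rowE mxE. Qed.

Lemma mul_outer m (u : basis m) (w : 'rV['F_2]_m) (x : basis m) :
  u *m w *m x = row_dot w x *: u.
Proof. by rewrite -mulmxA [w *m x]mx11_scalar mul_mx_scalar. Qed.

Lemma gate_op_ket m (g : gate m) x : gate_op C g (ket C x) = gate_ket C g x.
Proof. exact: lin_ext_ket. Qed.

Lemma realizes_CNOT m (s t : 'I_m) : s != t ->
  realizes 0 (mulmx (1%:M + (delta_mx t 0 : basis m) *m delta_mx 0 s)).
Proof.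
move=> neq_st; exists [:: CNOT_gate neq_st] => // x.
rewrite /= comp_lfun1l gate_op_ket /=.
by rewrite set_bitD mulmxDl mul1mx mul_outer row_dot_delta.
Qed.

(* A Toffoli gate up to a linear change of basis. *)
Definition tof_map m (w1 w2 : 'rV['F_2]_m) (u y : basis m) : basis m :=
  y + (row_dot w1 y * row_dot w2 y) *: u.

Lemma realizes_TOF m (i j t : 'I_m) : uniq [:: i; j; t] ->
  realizes 1 (tof_map (delta_mx 0 i) (delta_mx 0 j) (delta_mx t 0)).
Proof.
move=> ijt; exists [:: TOF_gate ijt] => // x.
rewrite /= comp_lfun1l gate_op_ket /=.
by rewrite set_bitD /tof_map !row_dot_delta.
Qed.

Lemma realizes_mul m (P Q : 'M['F_2]_m) :
  realizes 0 (mulmx P) -> realizes 0 (mulmx Q) -> realizes 0 (mulmx (P *m Q)).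
Proof.
move=> rP rQ; apply: realizes_ext (realizes_comp rQ rP) => x /=.
exact: mulmxA.
Qed.

(** CNOT gates with common target [s] multiply by adding their rows: the cross term contains v1 e_s,
    the entry of v1 at [s], which is 0. The predicate [K] carries this vanishing through the sum. *)
Lemma realizes_fan_in m (s : 'I_m) (w : 'rV['F_2]_m) :
  w 0 s = 0 -> realizes 0 (mulmx (1%:M + (delta_mx s 0 : basis m) *m w)).
Proof.
move=> ws; rewrite [w]row_sum_delta.
pose K (v : 'rV['F_2]_m) :=
  v 0 s = 0 /\ realizes 0 (mulmx (1%:M + (delta_mx s 0 : basis m) *m v)).
suff [] : K (\sum_j w 0 j *: delta_mx 0 j) by [].
apply: (big_ind K) => [|v1 v2 [v1s r1] [v2s r2]|j _].
- split; first by rewrite mxE.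
  apply: realizes_ext (realizes_id m) => x.
  by rewrite mulmx0 addr0 mul1mx.
- split; first by rewrite mxE v1s v2s addr0.
  have v1e : v1 *m delta_mx s (0 : 'I_1) = 0.
    by apply/colP=> k; rewrite -colE !mxE ord1 v1s.
  have -> : 1%:M + (delta_mx s 0 : basis m) *m (v1 + v2) =
      (1%:M + (delta_mx s 0 : basis m) *m v1) *m
      (1%:M + (delta_mx s 0 : basis m) *m v2).
    rewrite mulmxDl !mulmxDr !mul1mx mulmx1 -mulmxA [v1 *m _]mulmxA v1e.
    by rewrite mul0mx mulmx0 addr0 addrA addrAC.
  exact: realizes_mul.
case: (F2_cases (w 0 j)) => wj.
  rewrite wj scale0r; split; first by rewrite mxE.
  apply: realizes_ext (realizes_id m) => x.
  by rewrite mulmx0 addr0 mul1mx.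
have neq_js : j != s by apply: contra_eq_neq ws => <-; rewrite wj.
rewrite wj scale1r; split; last exact: realizes_CNOT.
by rewrite mxE eq_sym (negPf neq_js).
Qed.

(** Dual to fan-in: with common control [t] the columns add, since the cross term contains the entry
    of v2 at [t]. *)
Lemma realizes_fan_out m (t : 'I_m) (u : basis m) :
  u t 0 = 0 -> realizes 0 (mulmx (1%:M + u *m delta_mx 0 t)).
Proof.
move=> ut; have -> : u = \sum_j u j 0 *: delta_mx j 0.
  rewrite [LHS]matrix_sum_delta exchange_big big_ord1 /=.
  by apply: eq_bigr => j _.
pose K (v : basis m) :=
  v t 0 = 0 /\ realizes 0 (mulmx (1%:M + v *m delta_mx 0 t)).
suff [] : K (\sum_j u j 0 *: delta_mx j 0) by [].
apply: (big_ind K) => [|v1 v2 [v1t r1] [v2t r2]|j _].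
- split; first by rewrite mxE.
  apply: realizes_ext (realizes_id m) => x.
  by rewrite mul0mx addr0 mul1mx.
- split; first by rewrite mxE v1t v2t addr0.
  have ev2 : delta_mx (0 : 'I_1) t *m v2 = 0.
    by apply/rowP=> k; rewrite -rowE !mxE ord1 v2t.
  have -> : 1%:M + (v1 + v2) *m delta_mx 0 t =
      (1%:M + v1 *m delta_mx 0 t) *m (1%:M + v2 *m delta_mx 0 t).
    rewrite mulmxDl !mulmxDr !mulmxDl !mul1mx mulmx1 -[v1 *m _ *m _]mulmxA.
    by rewrite [_ *m (v2 *m _)]mulmxA ev2 mul0mx mulmx0 addr0 addrA addrAC.
  exact: realizes_mul.
case: (F2_cases (u j 0)) => uj.
  rewrite uj scale0r; split; first by rewrite mxE.
  apply: realizes_ext (realizes_id m) => x.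
  by rewrite mul0mx addr0 mul1mx.
have neq_tj : t != j by apply: contra_eq_neq ut => ->; rewrite uj.
rewrite uj scale1r; split; last exact: realizes_CNOT.
by rewrite mxE (negPf neq_tj).
Qed.

Lemma realizes_tof_map_conj m r (P : 'M['F_2]_m) w1 w2 u :
    P *m P = 1%:M -> realizes 0 (mulmx P) -> realizes r (tof_map w1 w2 u) ->
  realizes r (tof_map (w1 *m P) (w2 *m P) (P *m u)).
Proof.
move=> PP rP rT; have := realizes_comp (realizes_comp rP rT) rP.
rewrite add0n addn0; apply: realizes_ext => y /=.
by rewrite /tof_map mulmxDr -scalemxAr mulmxA PP mul1mx /row_dot !mulmxA.
Qed.

Lemma outer_involutive m (u : basis m) (w : 'rV['F_2]_m) :
  w *m u = 0 -> (1%:M + u *m w) *m (1%:M + u *m w) = 1%:M.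
Proof.
move=> wu; rewrite mulmxDl !mulmxDr !mul1mx mulmx1 -mulmxA [w *m _]mulmxA wu.
by rewrite mul0mx mulmx0 addr0 -addrA F2_addvv addr0.
Qed.

(** Two conjugations by CNOT circuits straighten the data: a fan-in [P] turns the row e_s into [v],
    then a fan-out [G] turns the column e_t into P u while fixing the rows e_i and e_s. What remains
    is one Toffoli gate on [i], [s], [t]. *)
Lemma realizes_tof_map m (i : 'I_m) (v : 'rV['F_2]_m) (u : basis m) :
    v != 0 -> u != 0 -> v 0 i = 0 -> u i 0 = 0 -> v *m u = 0 ->
  realizes 1 (tof_map (delta_mx 0 i) v u).
Proof.
move=> v_neq0 u_neq0 vi ui vu.
have /rV0Pn [s /F2_neq0 vs] := v_neq0.
(* Removing the entry of [v] at [s] makes [P] an involution, and e_s P = e_s + w = v. *)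
pose w := v + delta_mx 0 s.
pose P := 1%:M + (delta_mx s 0 : basis m) *m w.
have ws : w 0 s = 0 by rewrite !mxE !eqxx vs; apply: val_inj.
have w_e : w *m delta_mx s (0 : 'I_1) = 0.
  by apply/colP=> k; rewrite -colE !mxE !ord1 -[RHS]ws !mxE.
have PP : P *m P = 1%:M by exact: outer_involutive.
have neq_is : i != s by apply: contra_eq_neq vi => ->; rewrite vs.
pose u' := P *m u.
have u'_neq0 : u' != 0.
  apply: contraNneq u_neq0 => u'0.
  by rewrite -[u]mul1mx -PP -mulmxA -/u' u'0 mulmx0.
have eiP : delta_mx 0 i *m P = delta_mx 0 i :> 'rV_m.
  rewrite mulmxDr mulmx1 mulmxA mul_delta_mx_cond.
  by rewrite (negPf neq_is) mulr0n mul0mx addr0.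
have esP : delta_mx 0 s *m P = v :> 'rV_m.
  rewrite mulmxDr mulmx1 mulmxA mul_delta_mx.
  rewrite (_ : delta_mx 0 0 = 1%:M) ?mul1mx; last first.
    by apply/matrixP=> a b; rewrite !ord1 !mxE.
  by rewrite /w addrCA F2_addvv addr0.
have u'i : u' i 0 = 0.
  rewrite -row_dot_delta /row_dot mulmxA eiP.
  by rewrite -/(row_dot _ _) row_dot_delta.
(* Here v u = 0 is what keeps the target [t], chosen next, different from the control [s]. *)
have u's : u' s 0 = 0 by rewrite -row_dot_delta /row_dot mulmxA esP vu mxE.
have /cV0Pn [t /F2_neq0 u't] := u'_neq0.
pose u0 := u' + delta_mx t 0.
pose G := 1%:M + u0 *m delta_mx 0 t.
have u0t : u0 t 0 = 0 by rewrite mxE u't mxE !eqxx; apply: val_inj.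
have neq_it : i != t by apply: contra_eq_neq u'i => ->; rewrite u't.
have neq_st : s != t by apply: contra_eq_neq u's => ->; rewrite u't.
have eG k : k != t -> u' k 0 = 0 -> delta_mx 0 k *m G = delta_mx 0 k :> 'rV_m.
  move=> neq_kt u'k; rewrite mulmxDr mulmx1 mulmxA -rowE.
  have -> : row k u0 = 0.
    apply/rowP=> a; rewrite ord1 mxE [u0 _ _]mxE u'k.
    by rewrite !mxE (negPf neq_kt) addr0.
  by rewrite mul0mx addr0.
have Ge : G *m delta_mx t 0 = u'.
  rewrite mulmxDl mul1mx -mulmxA mul_delta_mx.
  rewrite (_ : delta_mx 0 0 = 1%:M) ?mulmx1; last first.
    by apply/matrixP=> a b; rewrite !ord1 !mxE.
  by rewrite /u0 addrCA F2_addvv addr0.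
have GG : G *m G = 1%:M.
  apply: outer_involutive; rewrite -rowE.
  by apply/rowP=> a; rewrite ord1 mxE u0t mxE.
have uE : u = P *m u' by rewrite mulmxA PP mul1mx.
rewrite -eiP -esP uE.
apply: realizes_tof_map_conj => //; first exact: realizes_fan_in.
rewrite -(eG i) // -(eG s) // -Ge.
apply: realizes_tof_map_conj => //; first exact: realizes_fan_out.
by apply: realizes_TOF; rewrite /= !inE negb_or neq_is neq_it neq_st.
Qed.

(** * Controlled linear maps and the upper bound *)

Definition ctl_map n (A : 'M['F_2]_n) (y : basis (1 + n)) : basis (1 + n) :=
  if usubmx y == 0 then y else col_mx (usubmx y) (A *m dsubmx y).

Lemma F2_cV1_neq0 (b : basis 1) : b != 0 -> b = const_mx 1.
Proof.
by move=> /cV0Pn [i /F2_neq0 bi]; apply/colP=> j; rewrite !ord1 mxE -bi ord1.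
Qed.

Lemma ctl_mapM n (A B : 'M['F_2]_n) y :
  ctl_map (A *m B) y = ctl_map A (ctl_map B y).
Proof.
rewrite /ctl_map; case: (eqVneq (usubmx y) 0) => [->|y_neq0].
  by rewrite eqxx.
by rewrite col_mxKu col_mxKd (negPf y_neq0) mulmxA.
Qed.

(** With control bit b and target x, the vector added is b (v x) u: a product of two linear forms
    times a fixed vector. *)
Lemma ctl_map_transvection n (u : basis n) (v : 'rV['F_2]_n) y :
  ctl_map (1%:M + u *m v) y =
  tof_map (delta_mx 0 (lshift n 0)) (row_mx 0 v) (col_mx 0 u) y.
Proof.
rewrite /tof_map row_dot_delta -{2 3 4}[y]vsubmxK col_mxEu.
rewrite /row_dot mul_row_col mul0mx add0r -/(row_dot v _).
rewrite scale_col_mx add_col_mx scaler0 addr0 /ctl_map.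
case: eqVneq => [y0|/F2_cV1_neq0 y1].
  by rewrite y0 mxE mul0r scale0r addr0 -y0 vsubmxK.
by rewrite y1 mxE mul1r mulmxDl mul1mx mul_outer.
Qed.

Lemma realizes_ctl_transvection n (u : basis n) (v : 'rV['F_2]_n) :
  u != 0 -> v != 0 -> v *m u = 0 -> realizes 1 (ctl_map (1%:M + u *m v)).
Proof.
move=> u_neq0 v_neq0 vu.
apply: (realizes_ext (fun y => esym (ctl_map_transvection u v y))).
apply: realizes_tof_map.
- apply: contraNneq v_neq0 => /(congr1 rsubmx).
  by rewrite row_mxKr linear0 => ->.
- apply: contraNneq u_neq0 => /(congr1 dsubmx).
  by rewrite col_mxKd linear0 => ->.
- by rewrite row_mxEl mxE.
- by rewrite col_mxEu mxE.
by rewrite mul_row_col mul0mx vu addr0.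
Qed.

(** The functionals killing [p] and those killing [q] are two proper subspaces, whose union is never
    the whole space. Explicitly, a coordinate equal to 1 in both vectors works; otherwise the sum of
    a coordinate of each does, as the mixed entries vanish. *)
Lemma F2_common_functional n (p q : 'cV['F_2]_n) :
    p != 0 -> q != 0 ->
  exists y : 'rV['F_2]_n, y *m p = 1%:M /\ y *m q = 1%:M.
Proof.
move=> /cV0Pn [i /F2_neq0 pi] /cV0Pn [j /F2_neq0 qj].
have dE (k : 'I_n) (r : 'cV['F_2]_n) : delta_mx (0 : 'I_1) k *m r = (r k 0)%:M.
  by rewrite -rowE; apply/rowP=> a; rewrite !mxE !ord1 eqxx.
case: (F2_cases (q i 0)) => qi; last first.
  by exists (delta_mx 0 i); rewrite !dE pi qi.
case: (F2_cases (p j 0)) => pj; last first.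
  by exists (delta_mx 0 j); rewrite !dE pj qj.
exists (delta_mx 0 i + delta_mx 0 j).
by rewrite !mulmxDl !dE pi pj qi qj -!raddfD /= addr0 add0r.
Qed.

(* With u = (A - 1) x and v A = y (A - 1), the matrix (1 + u v) A - 1 equals
   (A - 1) (1 + x y (A - 1)), whose rank is one less than that of A - 1 as soon
   as y (A - 1) x = 1; and v u = 0 amounts to y (A^-1 (A - 1) x) = 1. *)
Lemma transvection_reduction n (A : 'M['F_2]_n) :
    A \in unitmx -> A != 1%:M ->
  exists (u : basis n) (v : 'rV['F_2]_n),
    [/\ u != 0, v != 0, v *m u = 0
     & (\rank ((1%:M + u *m v) *m A - 1%:M)).+1 = \rank (A - 1%:M)].
Proof.
move=> A_unit A_neq1; pose N := A - 1%:M.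
have [x p_neq0] : exists x : basis n, N *m x != 0.
  have : N != 0 by rewrite subr_eq0.
  case/matrix0Pn=> i [j Nij]; exists (delta_mx j 0); rewrite -colE.
  by apply/cV0Pn; exists i; rewrite mxE.
pose p := N *m x; pose q := invmx A *m p.
have q_neq0 : q != 0.
  apply: contraNneq p_neq0 => q0.
  by rewrite -/p -[p](mulKVmx A_unit) -/q q0 mulmx0.
have [y [yp yq]] := F2_common_functional p_neq0 q_neq0.
pose w := y *m N; pose v := w *m invmx A.
have vA : v *m A = w by rewrite /v mulmxKV.
have wx : w *m x = 1%:M by rewrite /w -mulmxA.
have w_neq0 : w != 0.
  apply/eqP => w0; move: wx; rewrite w0 mul0mx => /rowP/(_ 0).
  by rewrite !mxE.
have v_neq0 : v != 0.
  by apply: contraNneq w_neq0 => v0; rewrite -vA v0 mul0mx.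
exists p, v; split => //.
  have -> : v = y - y *m invmx A.
    by rewrite /v /w /N mulmxBr mulmx1 mulmxBl mulmxK.
  by rewrite mulmxBl -mulmxA -/q yp yq subrr.
have -> : (1%:M + p *m v) *m A - 1%:M = N *m (1%:M + x *m w).
  by rewrite mulmxDl mul1mx -mulmxA vA mulmxDr mulmx1 mulmxA addrAC.
rewrite -/N -(mxrank_mul_ker N (1%:M + x *m w)) -addn1; congr addn.
(* The rank lost is the dimension of the row space of [N] inside the left kernel of 1 + x w. That
   kernel is the line of [w], since z (1 + x w) = 0 forces z = (z x) w, and w = y N does lie in the
   row space. *)
have capE : (N :&: kermx (1%:M + x *m w) == w)%MS.
  apply/andP; split.
    apply: submx_trans (capmxSr _ _) _; apply/rV_subP => z /sub_kermxP.
    rewrite mulmxDr mulmx1 mulmxA [z *m x]mx11_scalar mul_scalar_mx.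
    by move/eqP; rewrite addr_eq0 => /eqP ->; rewrite eqmx_opp scalemx_sub.
  rewrite sub_capmx submxMl /=; apply/sub_kermxP.
  by rewrite mulmxDr mulmx1 mulmxA wx mul1mx F2_addvv.
by rewrite (eqmxP capE) rank_rV w_neq0.
Qed.

(** Induction on the rank: a transvection T makes the rank of T A - 1 one smaller, and T T = 1
    recovers A = T (T A) for one more Toffoli gate. *)
Lemma realizes_ctl_map n (A : 'M['F_2]_n) :
  A \in unitmx -> realizes (\rank (A - 1%:M)) (ctl_map A).
Proof.
elim: (\rank _) {-2}A (erefl (\rank (A - 1%:M))) => {A} [|r IHr] A.
  move=> /eqP; rewrite mxrank_eq0 subr_eq0 => /eqP -> _.
  rewrite subrr mxrank0.
  apply: realizes_ext (realizes_id (1 + n)) => y.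
  by rewrite /ctl_map mul1mx vsubmxK if_same.
move=> rankA A_unit.
have A_neq1 : A != 1%:M.
  by apply: contra_eq_neq rankA => ->; rewrite subrr mxrank0.
have [u [v [u_neq0 v_neq0 vu]]] := transvection_reduction A_unit A_neq1.
rewrite rankA => -[rankTA].
have TT := outer_involutive vu; set T := 1%:M + u *m v in rankTA TT.
have T_unit : T \in unitmx by case: (mulmx1_unit TT).
have TA_unit : T *m A \in unitmx by rewrite unitmx_mul T_unit.
have := realizes_comp (IHr _ rankTA TA_unit)
  (realizes_ctl_transvection u_neq0 v_neq0 vu).
rewrite rankTA addn1; apply: realizes_ext => y /=.
by rewrite -ctl_mapM mulmxA TT mul1mx.
Qed.

Lemma tens_ket m n (x : basis m) (y : basis n) :
  tens (ket C x) (ket C y) = ket C (col_mx x y).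
Proof.
apply/ffunP=> z; rewrite !ffunE -natrM mulnb; congr (_ (nat_of_bool _)).
rewrite -{3}[z]vsubmxK.
by apply/andP/eqP => [[/eqP-> /eqP->]|/eq_col_mx[-> ->]].
Qed.

Lemma controlled_ket n (U : 'End(state C n)) (A : 'M['F_2]_n) y :
    (forall x, U (ket C x) = ket C (A *m x)) ->
  controlled U (ket C y) = ket C (ctl_map A y).
Proof.
move=> UE; rewrite /controlled lin_ext_ket /ctl_map.
by case: eqVneq => // /F2_cV1_neq0 ->; rewrite UE tens_ket.
Qed.

Lemma controlled_implementable n (U : 'End(state C n)) (A : 'M['F_2]_n) :
  parity_matrix U A ->
  implementable_with (controlled U) (\rank (A - 1%:M)).
Proof.
case=> A_unit UE; have [c cE ct] := realizes_ctl_map A_unit.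
by exists c => //; apply: eq_on_ket => y; rewrite cE (controlled_ket _ UE).
Qed.

(** * Pauli operators and their images under gates *)

Definition sgn (z : 'F_2) : C := (-1) ^+ z.

Lemma sgn0 : sgn 0 = 1. Proof. by []. Qed.
Lemma sgn1 : sgn 1 = -1. Proof. by []. Qed.

Lemma F2_11 : 1 + 1 = 0 :> 'F_2. Proof. exact: F2_addrr. Qed.

Lemma sgnD (y z : 'F_2) : sgn (y + z) = sgn y * sgn z.
Proof.
case: (F2_cases y) => ->; first by rewrite add0r sgn0 mul1r.
case: (F2_cases z) => ->; first by rewrite addr0 sgn0 mulr1.
by rewrite F2_11 sgn0 sgn1 mulrNN mulr1.
Qed.

Lemma sgn_inj : injective sgn.
Proof.
move=> y z; case: (F2_cases y) => ->; case: (F2_cases z) => -> //;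
  rewrite sgn0 sgn1 => /eqP; last rewrite eq_sym.
  by rewrite eq_sym eqNr oner_eq0.
by rewrite eq_sym eqNr oner_eq0.
Qed.

Lemma row_dotD m (w : 'rV['F_2]_m) x y :
  row_dot w (x + y) = row_dot w x + row_dot w y.
Proof. by rewrite /row_dot mulmxDr mxE. Qed.

Lemma row_dotDl m (w w' : 'rV['F_2]_m) x :
  row_dot (w + w') x = row_dot w x + row_dot w' x.
Proof. by rewrite /row_dot mulmxDl mxE. Qed.

Lemma row_dotZ m (w : 'rV['F_2]_m) a x : row_dot w (a *: x) = a * row_dot w x.
Proof. by rewrite /row_dot -scalemxAr mxE. Qed.

Lemma row_dotZl m (w : 'rV['F_2]_m) a x : row_dot (a *: w) x = a * row_dot w x.
Proof. by rewrite /row_dot -scalemxAl mxE. Qed.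

Lemma row_dot_deltar m (w : 'rV['F_2]_m) i : row_dot w (delta_mx i 0) = w 0 i.
Proof. by rewrite /row_dot -colE mxE. Qed.

Lemma row_dot_inj m (w w' : 'rV['F_2]_m) : row_dot w =1 row_dot w' -> w = w'.
Proof. by move=> eq_w; apply/rowP => i; rewrite -!row_dot_deltar. Qed.

Lemma sgn_neq0 z : sgn z != 0.
Proof. by rewrite expf_neq0 // oppr_eq0 oner_eq0. Qed.

Lemma scale_ket_inj m (k l : C) (x y : basis m) :
  k != 0 -> k *: ket C x = l *: ket C y -> x = y /\ k = l.
Proof.
move=> k_neq0 /ffunP/(_ x); rewrite !ffunE eqxx [k *: _]mulr1.
case: eqVneq => [<- ->|_ k0]; first by rewrite [_ *: _]mulr1.
by rewrite k0 [_ *: _]mulr0 eqxx in k_neq0.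
Qed.

(* X^a Z^b, with v = (a, b). *)
Definition pauli m (v : 'rV['F_2]_(m + m)) : 'End(state C m) :=
  lin_ext (fun x => sgn (row_dot (rsubmx v) x) *: ket C (x + (lsubmx v)^T)).

Lemma pauli_ket m (v : 'rV['F_2]_(m + m)) x :
  pauli v (ket C x) = sgn (row_dot (rsubmx v) x) *: ket C (x + (lsubmx v)^T).
Proof. exact: lin_ext_ket. Qed.

(** Conjugation by [W] written as an intertwining relation; the scalar absorbs phases, so that only
    the label in F_2^(2m) is tracked. *)
Definition maps_pauli m (W : 'End(state C m)) (v w : 'rV['F_2]_(m + m)) :
  Prop :=
  exists k : C, (W \o pauli v = k *: (pauli w \o W))%VF.

Lemma maps_pauli_ket m (W : 'End(state C m)) v w k :
    (forall x, W (pauli v (ket C x)) = k *: pauli w (W (ket C x))) ->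
  maps_pauli W v w.
Proof.
move=> Wk; exists k; apply: eq_on_ket => x.
by rewrite scale_lfunE !comp_lfunE Wk.
Qed.

Lemma maps_pauli_id m v : @maps_pauli m \1%VF v v.
Proof. by exists 1; rewrite scale1r comp_lfun1l comp_lfun1r. Qed.

Lemma maps_pauli_comp m (V W : 'End(state C m)) u v w :
  maps_pauli V u v -> maps_pauli W v w -> maps_pauli (W \o V) u w.
Proof.
move=> [k Vuv] [l Wvw]; exists (k * l).
rewrite -comp_lfunA Vuv -comp_lfunZr [(W \o (_ \o _))%VF]comp_lfunA Wvw.
by rewrite -comp_lfunZl -comp_lfunA scalerA.
Qed.

Lemma mul_row_delta m p (a : 'rV['F_2]_m) (i : 'I_m) (j : 'I_p) :
  a *m delta_mx i j = a 0 i *: delta_mx 0 j.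
Proof.
apply/rowP => k; rewrite !mxE (bigD1 i) //= !mxE !eqxx.
by rewrite big1 ?addr0 // => l /negPf neq_l; rewrite !mxE neq_l mulr0.
Qed.

Lemma S_gate_pauli m (i : 'I_m) (v : 'rV['F_2]_(m + m)) :
  maps_pauli (gate_op C (S_gate i)) v
    (v *m block_mx 1%:M (delta_mx i i) 0 1%:M).
Proof.
rewrite -[v in v *m _]hsubmxK mul_row_block !mulmx1 mulmx0 addr0.
set a := lsubmx v; set b := rsubmx v.
(* S turns X into iXZ, hence one factor i when [a] has a 1 at [i]. *)
apply: (@maps_pauli_ket _ _ _ _ ('i ^+ (a 0 i))) => x.
rewrite [in RHS]gate_op_ket /= linearZ /= !pauli_ket linearZ /= gate_op_ket /=.
rewrite row_mxKl row_mxKr -/a -/b !scalerA; congr (_ *: _).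
rewrite row_dotDl mul_row_delta row_dotZl row_dot_delta sgnD; move: a b => a b.
rewrite !mxE.
case: (F2_cases (a 0 i)) => ->; first by rewrite mul0r addr0 sgn0 !mul1r mulrC.
case: (F2_cases (x i 0)) => ->.
  by rewrite add0r mulr0 sgn0 mulr1 mul1r mulrC.
(* Both bits are 1, so their sum wraps around to 0 while the exponents of i add up to 2; the sign of
   the new Z compensates. *)
rewrite F2_11 mulr1 sgn1 expr0 mulr1 mulrA.
by rewrite -[nat_of_ord 1]/1%N expr1 -expr2 sqrCi mulrNN mul1r mul1r.
Qed.

(** The block matrix exchanges the entries of a and b at [i]: H swaps X and Z, and restoring the
    order X before Z costs the sign (-1)^(a_i b_i). *)
Lemma H_gate_pauli m (i : 'I_m) (v : 'rV['F_2]_(m + m)) (E := delta_mx i i) :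
  maps_pauli (gate_op C (H_gate i)) v
    (v *m block_mx (1%:M + E) E E (1%:M + E)).
Proof.
rewrite -[v in v *m _]hsubmxK mul_row_block !mulmxDr !mulmx1 {}/E.
set a := lsubmx v; set b := rsubmx v.
rewrite !mul_row_delta -addrA -scalerDl [a 0 i *: _ + _]addrCA -scalerDl.
apply: (@maps_pauli_ket _ _ _ _ (sgn (a 0 i * b 0 i))) => x.
rewrite [in RHS]gate_op_ket /= pauli_ket !linearZ /= gate_op_ket /=.
rewrite [pauli _ (_ + _)]linearD /= [pauli _ (_ *: _)]linearZ /= !pauli_ket.
rewrite row_mxKl row_mxKr -/a -/b; move: a b => {v} a b.
have bitE (z : basis m) y : set_bit z i y = z + (z i 0 + y) *: delta_mx i 0.
  by rewrite -set_bitD addrA F2_addrr add0r.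
pose K y := ket C (x + a^T + y *: delta_mx i 0).
have KE t r :
    ket C (x + t *: delta_mx i 0 + (a + r *: delta_mx 0 i)^T) = K (t + r).
  by rewrite linearD linearZ /= trmx_delta addrACA -scalerDl.
have dotE t r : row_dot (b + r *: delta_mx 0 i) (x + t *: delta_mx i 0) =
    row_dot b x + (t * b 0 i + r * x i 0 + r * t).
  rewrite row_dotDl !row_dotD row_dotZ row_dot_deltar !row_dotZl row_dot_delta.
  by rewrite row_dotZ row_dot_delta mxE !eqxx mulr1 !addrA.
rewrite !bitE -!/(K _) !KE !dotE [(x + a^T) i 0]mxE [a^T i 0]mxE.
rewrite -!/(sgn _) !scalerDr !scalerA !(sgnD (row_dot b x)).
(* Each side is a combination of [K 0] and [K 1]; in each of the eight cases the terms match in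
   order or after a swap. *)
case: (F2_cases (a 0 i)) => ->; case: (F2_cases (b 0 i)) => ->;
  case: (F2_cases (x i 0)) => ->;
  rewrite ?(add0r, addr0, mul0r, mulr0, mulr1, F2_11) ?(sgn0, sgn1).
all: move: (sgn (row_dot b x)) (sqrtC 2)^-1 (K 0) (K 1) => p q k0 k1.
all: try by congr (_ *: _ + _ *: _);
  rewrite ?(mulrN1, mulNr, mulrN, opprK) mulrC.
all: by rewrite addrC; congr (_ *: _ + _ *: _);
  rewrite ?(mulrN1, mulNr, mulrN, opprK) mulrC.
Qed.

Lemma CNOT_gate_pauli m (s t : 'I_m) (neq_st : s != t) (v : 'rV['F_2]_(m + m)) :
  maps_pauli (gate_op C (CNOT_gate neq_st)) v
    (v *m block_mx (1%:M + delta_mx s t) 0 0 (1%:M + delta_mx t s)).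
Proof.
have neq_ts : (t == s) = false by rewrite eq_sym (negbTE neq_st).
rewrite -[v in v *m _]hsubmxK mul_row_block !mulmx0 addr0 add0r.
rewrite !mulmxDr !mulmx1 !mul_row_delta.
set a := lsubmx v; set b := rsubmx v.
apply: (@maps_pauli_ket _ _ _ _ 1) => x.
rewrite [in RHS]gate_op_ket /= scale1r !pauli_ket linearZ /= gate_op_ket /=.
rewrite row_mxKl row_mxKr -/a -/b !set_bitD.
move: a b => {v} a b.
congr (sgn _ *: ket C _).
  rewrite row_dotDl !row_dotD !row_dotZ !row_dotZl !row_dot_deltar.
  rewrite row_dot_delta.
  rewrite mxE neq_ts andbF !mulr0 addr0 [b 0 t * _]mulrC -addrA.
  by rewrite F2_addrr addr0.
rewrite linearD linearZ /= trmx_delta addrACA -scalerDl.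
by rewrite mxE [a^T _ _]mxE.
Qed.

(** With no X on the controls the product of the control bits is unchanged, and with no Z on the
    target the sign does not see the flip; so the operator commutes with the gate. *)
Lemma TOF_gate_pauli m (i j t : 'I_m) (ijt : uniq [:: i; j; t])
    (v : 'rV['F_2]_(m + m)) :
    v 0 (lshift m i) = 0 -> v 0 (lshift m j) = 0 -> v 0 (rshift m t) = 0 ->
  maps_pauli (gate_op C (TOF_gate ijt)) v v.
Proof.
move=> vi vj vt; apply: (@maps_pauli_ket _ _ _ _ 1) => x.
rewrite [in RHS]gate_op_ket /= scale1r !pauli_ket linearZ /= gate_op_ket /=.
rewrite !set_bitD row_dotD row_dotZ row_dot_deltar [rsubmx v 0 t]mxE vt.
rewrite mulr0 addr0.
by rewrite !mxE vi vj !addr0 addrAC.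
Qed.

Lemma clifford_gate_pauli m (g : gate m) : ~~ is_TOF g ->
  exists G, forall v, maps_pauli (gate_op C g) v (v *m G).
Proof.
case: g => [i|i|s t neq_st|//] _; eexists => v.
- exact: H_gate_pauli.
- exact: S_gate_pauli.
exact: CNOT_gate_pauli.
Qed.

(** * The lower bound *)

(** The columns of [M] are linear constraints on the label. A Clifford gate in front pulls them back
    along its linear action; a Toffoli gate in front adds three columns and leaves the label
    unchanged. *)
Lemma circuit_pauli m (c : circuit m) :
  exists M : 'M['F_2]_(m + m, 3 * toffoli_count c),
    forall v, v *m M = 0 -> exists w, maps_pauli (circuit_op C c) v w.
Proof.
elim: c => [|g c [M Mc]] /=.
  by exists 0 => v _; exists v; apply: maps_pauli_id.
case gT: (is_TOF g); last first.
  have [G gG] := clifford_gate_pauli (negbT gT).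
  exists (G *m M) => v; rewrite mulmxA => /Mc [w Mw]; exists w.
  exact: maps_pauli_comp (gG v) Mw.
case: g gT => //= i j t ijt _; rewrite mulnDr.
pose e (l : 'I_3) := tnth [tuple lshift m i; lshift m j; rshift m t] l.
exists (row_mx (\matrix_(k, l) (k == e l)%:R) M).
move=> v; rewrite mul_mx_row => /eqP; rewrite row_mx_eq0.
move=> /andP [/eqP v0 /eqP /Mc [w Mw]].
exists w; apply: maps_pauli_comp Mw.
have vE l : v 0 (e l) = 0.
  move/rowP/(_ l): v0; rewrite !mxE => <-.
  rewrite (bigD1 (e l)) //= !mxE eqxx mulr1.
  by rewrite big1 ?addr0 // => k /negPf neq_k; rewrite mxE neq_k mulr0.
apply: TOF_gate_pauli.
- exact: (vE 0).
- exact: (vE 1).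
exact: (vE 2).
Qed.

(** The relation is tested on kets. Control 0, where the unitary acts trivially, determines [k] and
    the part of [w] on the target; control 1 then compares this with the action of [A]. *)
Lemma ctl_map_pauli n (U : 'End(state C n)) (A : 'M['F_2]_n) (a b : 'rV_n) w :
    (forall x, U (ket C x) = ket C (A *m x)) ->
    maps_pauli (controlled U) (row_mx (row_mx 0 a) (row_mx 0 b)) w ->
  (A - 1%:M) *m a^T = 0 /\ b *m (A - 1%:M) = 0.
Proof.
move=> UE [k kE].
pose wa := (lsubmx w)^T; pose wb := rsubmx w.
have key y : ctl_map A (y + col_mx 0 a^T) = ctl_map A y + wa /\
    sgn (row_dot b (dsubmx y)) = k * sgn (row_dot wb (ctl_map A y)).
  apply: scale_ket_inj; first exact: sgn_neq0.
  have := congr1 (fun f : 'End(state C (1 + n)) => f (ket C y)) kE.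
  rewrite scale_lfunE !comp_lfunE !pauli_ket linearZ /= !(controlled_ket _ UE).
  rewrite pauli_ket row_mxKl row_mxKr tr_row_mx trmx0 scalerA => <-.
  rewrite -[y in row_dot (row_mx _ _) y]vsubmxK /row_dot mul_row_col.
  by rewrite mul0mx add0r.
have ctl0 x : ctl_map A (col_mx 0 x) = col_mx 0 x.
  by rewrite /ctl_map col_mxKu eqxx.
have ctl1 x : ctl_map A (col_mx (const_mx 1) x) = col_mx (const_mx 1) (A *m x).
  rewrite /ctl_map col_mxKu col_mxKd ifN //.
  by apply/eqP => /matrixP/(_ 0 0); rewrite !mxE.
have [waE kE1] : wa = col_mx 0 a^T /\ k = 1.
  have [] := key (col_mx 0 0).
  rewrite add_col_mx !addr0 add0r !ctl0 col_mx0 add0r.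
  by rewrite /row_dot linear0 !mulmx0 mxE mulr1 => ->.
have wb0 x : row_dot wb (col_mx 0 x) = row_dot b x.
  have [_] := key (col_mx 0 x); rewrite ctl0 col_mxKd kE1 mul1r.
  by move/sgn_inj.
(* A possible Z of [w] on the control contributes only a constant, which is seen to vanish at x =
   0. *)
have wb1 x :
    row_dot b x = row_dot wb (col_mx (const_mx 1) 0) + row_dot b (A *m x).
  have [_] := key (col_mx (const_mx 1) x); rewrite ctl1 col_mxKd kE1 mul1r.
  by move/sgn_inj ->; rewrite -wb0 -row_dotD add_col_mx addr0 add0r.
split.
  have [] := key (col_mx (const_mx 1) 0).
  rewrite add_col_mx addr0 add0r !ctl1 mulmx0 waE add_col_mx addr0 add0r.
  by case/eq_col_mx => _ aE _; rewrite mulmxBl mul1mx aE subrr.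
rewrite mulmxBr mulmx1; apply/eqP; rewrite subr_eq0; apply/eqP.
apply: row_dot_inj => x; rewrite wb1 {1}/row_dot -mulmxA -/(row_dot _ _).
have := wb1 0; rewrite mulmx0 /row_dot [b *m 0]mulmx0 mxE addr0 => <-.
by rewrite add0r.
Qed.

Lemma controlled_toffoli_lower_bound n (U : 'End(state C n))
    (A : 'M['F_2]_n) t :
  parity_matrix U A -> implementable_with (controlled U) t ->
  (2 * \rank (A - 1%:M)%R <= 3 * t)%N.
Proof.
move=> [_ UE] [c cU <-]; have [M McP] := circuit_pauli c.
pose N := A - 1%:M; pose D := block_mx N^T 0 0 N.
(* [J] embeds the Pauli labels of the target as labels that are trivial on the control qubit. *)
pose J : 'M['F_2]_(n + n, (1 + n) + (1 + n)) :=
  block_mx (row_mx 0 1%:M) 0 0 (row_mx 0 1%:M).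
have rankD : \rank D = (2 * \rank N)%N.
  by rewrite rank_diag_block_mx mxrank_tr mul2n addnn.
rewrite -rankD; apply: leq_trans (rank_leq_col (J *m M)).
(* The left kernel of J M lies in that of [D], so the rank 2r of [D] is at most the rank of J M,
   which has 3t columns. *)
have : (\rank (kermx (J *m M)) <= \rank (kermx D))%N.
  apply/mxrankS/rV_subP => v /sub_kermxP; rewrite mulmxA => /McP [w].
  rewrite cU -[v]hsubmxK mul_row_block !mulmx0 addr0 add0r !mul_mx_row.
  rewrite !mulmx0 !mulmx1.
  case/(ctl_map_pauli UE) => Na bN; apply/sub_kermxP.
  rewrite mul_row_block !mulmx0 addr0 add0r bN.
  by rewrite -[lsubmx v]trmxK -trmx_mul Na trmx0 row_mx0.
rewrite !mxrank_ker leq_sub2lE //; exact: rank_leq_row.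
Qed.

End Circuits.

(** The predicate is an arbitrary proposition, so the least element comes from strong induction and
    excluded middle. *)
Lemma ex_minimal (P : nat -> Prop) t :
  P t -> exists2 m, P m & forall s, P s -> (m <= s)%N.
Proof.
elim/ltn_ind: t => t IHt Pt.
have [[s Ps /IHt]|t_min] := classic (exists2 s, P s & (s < t)%N).
  exact.
exists t => // s Ps; rewrite leqNgt; apply/negP => lt_st.
by apply: t_min; exists s.
Qed.

Theorem theorem2 (C : numClosedFieldType) (n : nat) (U : 'End(state C n))
    (A : 'M['F_2]_n) (k : nat) (f : 'I_k -> {poly 'F_2}) (c : nat)
    (hU : is_CNOT_circuit_op U) (hA : parity_matrix U A)
    (hf : gen_jordan_form A f) (hc : c = X1_power_blocks f) :
  implementable_with (controlled U) (n - c) /\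
  exists2 opt : nat, is_toffoli_opt (controlled U) opt
    & (n - c)%N%:R <= 3 / 2 * opt%:R :> rat.
Proof.
rewrite hc -(rank_gen_jordan_form hf).
(* This implementation proves the first claim and also shows that a minimum exists. *)
have impl := controlled_implementable hA; split=> //.
have [opt opt_impl opt_min] := ex_minimal impl.
exists opt; first by [].
rewrite mulrAC ler_pdivlMr // mulrC -!natrM ler_nat.
exact: controlled_toffoli_lower_bound hA opt_impl.
Qed.
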